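(* Let $p,q\in\mathbb{R}[z]$ be polynomials of degree $d$ with distinct roots, let $\iota=(\phi,\psi)$ be the associated involution induced by complex conjugation, and let $B_d^\iota$ be the $\iota$-invariant Birkhoff polytope. (i) Let $M$ be a vertex of $B_d^\iota$ and let $\Gamma$ be the associated graph. Then the disjoint cycles of $\Gamma$ are all of types $1$–$4$ below. (ii) Conversely, let $\Gamma$ be an $\iota$-invariant bipartite multigraph on $[d]\times\{L,R\}$ (with $d$ vertices on each side) all of whose vertices have degree $2$. If all the disjoint cycles of $\Gamma$ are of types $1$–$4$, then $\Gamma$ is the graph associated to a vertex $M$ of $B_d^\iota$. Types of cycles: 1. $2$-cycles between fixed points of $\iota$; 2. pairs of $2$-cycles that are interchanged by $\iota$; 3. cycles of length $2(2k+1)$, $k>0$, including exactly one fixed point of $\iota$ on each side; 4. cycles of length $4k$, $k>0$, including exactly two fixed points of $\iota$ on one side and none on the other.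
   Context: Write the (distinct) roots of $p$ and $q$ as $\alpha_1,\dots,\alpha_d$ and $\beta_1,\dots,\beta_d$. The permutations $\phi,\psi\in\mathrm{Sym}(d)$ are defined by $\alpha_{\phi(i)}=\overline{\alpha_i}$ and $\beta_{\psi(j)}=\overline{\beta_j}$. $B_d$ is the Birkhoff polytope of $d\times d$ doubly stochastic matrices; $\iota$ acts on it by $(\iota M)_{ij}=M_{\phi(i)\psi(j)}$, and $B_d^\iota=\{M\in B_d:\iota M=M\}$. Every vertex $M$ of $B_d^\iota$ has entries in $\{0,\frac12,1\}$. The graph $\Gamma$ associated to a matrix $M$ with such entries is the bipartite multigraph with vertex set $[d]\times\{L,R\}$ (left side $L$, right side $R$) in which $(i,L)$ and $(j,R)$ are joined by $2M_{ij}$ edges, and there are no other edges. Every vertex of $\Gamma$ has degree $2$, so $\Gamma$ is a disjoint union of cycles of even length; a $2$-cycle consists of two vertices joined by a double edge. The disjoint cycles are the connected components of $\Gamma$. The involution $\iota$ acts on the vertices by $\iota(i,L)=(\phi(i),L)$ and $\iota(j,R)=(\psi(j),R)$; $\iota$-invariance of $\Gamma$ means that this is a graph automorphism (it preserves edge multiplicities). A cycle is ''of type 2'' if it is one member of a pair of distinct $2$-cycles of $\Gamma$ interchanged by $\iota$. *)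

(* Defs.v *)
From HB Require Import structures.
From mathcomp Require Import all_boot all_order all_algebra all_fingroup.
From mathcomp Require Import reals complex.

Set Implicit Arguments.
Unset Strict Implicit.
Unset Printing Implicit Defensive.

Import Order.TTheory GRing.Theory Num.Theory.
Local Open Scope ring_scope.

Section ConjugateRoots.
Variable R : realType.

(* When [size p = d.+1], the [d] distinct complex roots [alpha i] are all the
   roots of [p]. *)
Definition distinct_roots (d : nat) (p : {poly R}) (alpha : 'I_d -> R[i]) :=
  [/\ size p = d.+1, injective alpha &
      forall i, root (map_poly (real_complex R) p) (alpha i)].

Definition conj_perm (d : nat) (alpha : 'I_d -> R[i]) (s : 'S_d) :=
  forall i, alpha (s i) = conjc (alpha i).

End ConjugateRoots.

Section Birkhoff.
Variables (R : realType) (d : nat).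
Implicit Types (M : 'M[R]_d) (phi psi : 'S_d).

Definition birkhoff M :=
  [/\ forall i j, 0 <= M i j,
      forall i, \sum_j M i j = 1 &
      forall j, \sum_i M i j = 1].

(* [mxsub phi psi M] has entries [M (phi i) (psi j)]. *)
Definition birkhoff_iota phi psi M := birkhoff M /\ mxsub phi psi M = M.

End Birkhoff.

(* For a polytope [P], this is the usual notion of vertex (extreme point). *)
Definition is_vertex (R : realType) (V : lmodType R) (P : V -> Prop) (x : V) :=
  P x /\
  forall y z (t : R), P y -> P z -> 0 < t < 1 -> x = t *: y + (1 - t) *: z ->
    y = x /\ z = x.

(* A bipartite multigraph on [d] x {L, R} is given by the matrix [G] whose entry
   [G i j] is the number of edges joining (i, L) to (j, R). *)
Definition bigraph (d : nat) := 'M[nat]_d.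

(* [inl i] is the vertex (i, L), and [inr j] is the vertex (j, R). *)
Definition bivertex (d : nat) : finType := ('I_d + 'I_d)%type.

Section Bigraph.
Variable d : nat.
Implicit Types (G : bigraph d) (u v : bivertex d) (C : {set bivertex d}).
Implicit Types (phi psi : 'S_d).

Definition edge_mult G u v : nat :=
  match u, v with
  | inl i, inr j => G i j
  | inr j, inl i => G i j
  | _, _ => 0%N
  end.

Definition adjacent G : rel (bivertex d) := [rel u v | (0 < edge_mult G u v)%N].

Definition degree G u : nat := (\sum_v edge_mult G u v)%N.

Definition iotaV phi psi v : bivertex d :=
  match v with inl i => inl (phi i) | inr j => inr (psi j) end.

Definition iota_invariant phi psi G :=
  forall u v, edge_mult G (iotaV phi psi u) (iotaV phi psi v) = edge_mult G u v.

(* The disjoint cycles of a 2-regular [G] are its connected components, each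
   given by its vertex set [C]. The length of the cycle is [#|C|], also for a
   2-cycle, where the two vertices are joined by a double edge. *)
Definition is_cycle G C := exists v, C = [set w | connect (adjacent G) v w].

Definition is_left v := if v is inl _ then true else false.

Definition fixed_left phi psi C :=
  [set v in C | is_left v & iotaV phi psi v == v].

Definition fixed_right phi psi C :=
  [set v in C | ~~ is_left v & iotaV phi psi v == v].

Definition cycle_type1 phi psi C :=
  #|C| = 2%N /\ forall v, v \in C -> iotaV phi psi v = v.

Definition cycle_type2 phi psi G C :=
  #|C| = 2%N /\
  exists C', [/\ is_cycle G C', #|C'| = 2%N, C' <> C,
                 iotaV phi psi @: C = C' & iotaV phi psi @: C' = C].

Definition cycle_type3 phi psi C :=
  [/\ exists k, (0 < k)%N /\ #|C| = (2 * (2 * k + 1))%N,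
      #|fixed_left phi psi C| = 1%N & #|fixed_right phi psi C| = 1%N].

Definition cycle_type4 phi psi C :=
  (exists k, (0 < k)%N /\ #|C| = (4 * k)%N) /\
  ((#|fixed_left phi psi C| = 2%N /\ #|fixed_right phi psi C| = 0%N) \/
   (#|fixed_left phi psi C| = 0%N /\ #|fixed_right phi psi C| = 2%N)).

Definition all_cycles_typed phi psi G :=
  forall C, is_cycle G C ->
    [\/ cycle_type1 phi psi C, cycle_type2 phi psi G C,
        cycle_type3 phi psi C | cycle_type4 phi psi C].

End Bigraph.

(* [G] is determined by [M]; it exists iff the entries of [M] are natural
   multiples of 1/2, which for [M] in the Birkhoff polytope means that they lie
   in {0, 1/2, 1}. *)
Definition associated_graph (R : realType) (d : nat) (M : 'M[R]_d)
    (G : bigraph d) :=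
  forall i j, (G i j)%:R = 2 * M i j.

(* Main.v *)
Require Import Defs.
From HB Require Import structures.
From mathcomp Require Import all_boot all_order all_algebra all_fingroup.
From mathcomp Require Import reals complex.
From mathcomp Require Import zify lra.

Set Implicit Arguments.
Unset Strict Implicit.
Unset Printing Implicit Defensive.

Import Order.TTheory GRing.Theory Num.Theory.
Local Open Scope ring_scope.

(** Only the fact that phi and psi are involutions matters; it holds because
complex conjugation is an involution and the roots are distinct.

From vertices to graphs. By Hall's theorem the support of a doubly stochastic
M contains a permutation s ([birkhoff_support_perm]). The iota-average of its
permutation matrix is a point of the invariant polytope that can be subtracted
from M with a small positive weight, so if M is a vertex then M equals this
average ([vertex_perm_graph]): the graph of M consists of the edges i -- s i
and of their images i -- s' i under iota, where s' = psi s phi.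

Identify each right vertex s i with i. The action of iota on the right vertices
becomes the involution b = s^-1 psi s of the left ones, and walking along an
edge of s and back along an edge of s' is the permutation tau = phi b. So the
cycles of the graph are the orbits O of tau ([perm_graph_component]), and their
shape is a question about the dihedral action of phi and b on O.
- If phi maps O to another orbit, replace s by s' outside O. The result is
  another permutation in the support of M, so M is its average too. On O this
  average is the matrix of s, so s = s' there, O is a singleton, and the cycle
  is a 2-cycle exchanged with a different one.
- If phi preserves O, it acts on O, a cycle of length n, as a reflection
  k |-> c - k modulo n, and b as k |-> c - 1 - k. Solving 2 k = c and
  2 k + 1 = c modulo n gives one fixed point each for odd n; for even n one of
  the two has two fixed points and the other none ([card_fixed_porbit]).

From graphs to vertices. If M = G / 2 is a proper convex combination of two
points of the invariant polytope, then these are supported on the edges of G, so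
it is enough that M is the only point of the polytope with this property
([typed_graph_vertex]). The difference D of two such points is an
iota-invariant weighting of the edges with zero sum at every vertex. On a cycle
its values alternate in sign, so D vanishes on a cycle as soon as it vanishes
on one edge ([flow_component]). It does so on a 2-cycle, where the sum at a
vertex has a single term. A longer typed cycle has two fixed points but more
than two vertices, so some fixed vertex has a neighbour that iota moves; iota
then exchanges its two edges, on which D is both equal and opposite
([flow_swap]). *)

(** * Hall's marriage theorem *)

(** Rado's argument: shrink the sets A i while the hypothesis survives. If some
A i0 has two elements x and y, then one of them can be removed: otherwise both
removals break the condition, on index sets S and T containing i0, and the
inequality |X| + |Y| = |X :|: Y| + |X :&: Y|, used for S and T and for the
corresponding unions, contradicts the condition on S :|: T and on S :&: T minus
i0. When all the sets are singletons, the condition on pairs is injectivity. *)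
Lemma hall_marriage (I J : finType) (A : I -> {set J}) :
  (forall S : {set I}, #|S| <= #|\bigcup_(i in S) A i|)%N ->
  exists2 f : I -> J, injective f & forall i, f i \in A i.
Proof.
have [n] := ubnP (\sum_i #|A i|); elim: n A => // n IHn A ltAn hallA.
have [/forallP A1|] := boolP [forall i, #|A i| <= 1]%N.
  have Aex i : exists j, A i = [set j].
    apply/cards1P; rewrite eqn_leq A1 /=.
    by have := hallA [set i]; rewrite big_set1 cards1.
  have [f Af] := fin_all_exists Aex.
  exists f => [i j eq_f|i]; last by rewrite Af set11.
  apply/eqP/contraT => neq_ij; have := hallA [set i; j].
  by rewrite bigcup_setU !big_set1 !Af eq_f setUid cards1 cards2 neq_ij.
rewrite negb_forall => /existsP[i0].
rewrite -ltnNge => /card_gt1P[x [y [Ax Ay xy]]].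
(* B z is the family A with z removed from A i0. *)
pose B z i := if i == i0 then A i0 :\ z else A i.
have sBA z i : B z i \subset A i.
  by rewrite /B; case: eqP => // ->; apply: subsetDl.
(* An index set avoiding i0 does not see the removal, so a violation contains i0. *)
have [[z Az hallB]|noB] : (exists2 z, z \in A i0 &
     [forall S : {set I}, #|S| <= #|\bigcup_(i in S) B z i|]%N) \/
   (forall z, z \in A i0 ->
     exists2 S : {set I}, i0 \in S & #|\bigcup_(i in S) B z i| < #|S|)%N.
- have [/existsP[z /andP[Az hallB]]|/existsPn noB] :=
      boolP [exists z, (z \in A i0) &&
        [forall S : {set I}, #|S| <= #|\bigcup_(i in S) B z i|]%N].
    by left; exists z.
  right=> z Az; have := noB z; rewrite Az /= negb_forall => /existsP[S].
  rewrite -ltnNge => ltS; exists S => //; apply: contraLR ltS => Si0.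
  rewrite -leqNgt (leq_trans (hallA S)) // subset_leq_card //.
  apply/bigcupsP => i Si; apply: (bigcup_max i) => //.
  by rewrite /B ifN //; apply: contraNneq Si0 => <-.
- have [|T|f injf Bf] := IHn (B z).
  + rewrite -ltnS (leq_trans _ ltAn) // ltnS (bigD1 i0) //=.
    rewrite [ltnRHS](bigD1 i0) //= -addSn leq_add //.
      by rewrite /B eqxx [ltnRHS](cardsD1 z) Az.
    by apply: leq_sum => i _; apply/subset_leq_card/sBA.
  + exact: (forallP hallB).
  by exists f => // i; apply: subsetP (Bf i); apply: sBA.
have [S Si0 ltS] := noB x Ax; have [T Ti0 ltT] := noB y Ay.
set U := \bigcup_(i in S) _ in ltS; set V := \bigcup_(i in T) _ in ltT.
have leU : (#|S :|: T| <= #|U :|: V|)%N.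
  apply: leq_trans (hallA _) (subset_leq_card _); apply/bigcupsP => i STi.
  have [->|i0i] := eqVneq i i0.
    apply/subsetP => j Aj; rewrite inE; apply/orP.
    have [jx|jx] := eqVneq j x; [right|left]; apply/bigcupP; exists i0 => //.
      by rewrite /B eqxx !inE Aj jx xy.
    by rewrite /B eqxx !inE Aj jx.
  apply/subsetP => j Aj; rewrite inE; apply/orP.
  by move: STi; rewrite inE => /orP[Si|Ti]; [left|right];
     apply/bigcupP; exists i; rewrite // /B (negbTE i0i).
have leI : (#|(S :&: T) :\ i0| <= #|U :&: V|)%N.
  apply: leq_trans (hallA _) (subset_leq_card _); apply/bigcupsP => i.
  rewrite !inE => /and3P[i0i Si Ti]; apply/subsetP => j Aj; rewrite inE.
  by apply/andP; split; apply/bigcupP; exists i; rewrite // /B (negbTE i0i).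
have := cardsUI S T; have := cardsUI U V.
have := cardsD1 i0 (S :&: T); rewrite inE Si0 Ti0; lia.
Qed.

(** * Permutations in the support of a vertex *)

Section Vertices.
Variables (R : realType) (d : nat) (phi psi : 'S_d).
Implicit Types (M : 'M[R]_d) (G : bigraph d) (s : 'S_d).

(** Hall's condition for the support: the rows in S carry total weight |S|, all
of it in the columns of N, whose total weight is |N|. *)
Lemma birkhoff_support_perm M :
  birkhoff M -> exists s : 'S_d, forall i, 0 < M i (s i).
Proof.
case=> M_ge0 Mrow Mcol.
have [S|f injf Mf] := @hall_marriage _ _ (fun i => [set j | 0 < M i j]).
  set N := \bigcup_(i in S) _; rewrite -(ler_nat R).
  have -> : #|S|%:R = \sum_(i in S) \sum_(j in N) M i j.
    rewrite -sum1_card natr_sum; apply: eq_bigr => i Si.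
    rewrite -(Mrow i) [LHS](bigID (mem N)) /= [X in _ + X]big1 ?addr0 // => j Nj.
    apply/eqP; rewrite eq_le M_ge0 andbT leNgt; apply: contra Nj => Mij.
    by apply/bigcupP; exists i; rewrite ?inE.
  rewrite exchange_big -sum1_card natr_sum; apply: ler_sum => j _ /=.
  by rewrite -(Mcol j) [leRHS](bigID (mem S)) lerDl sumr_ge0.
by exists (perm injf) => i; have := Mf i; rewrite permE inE.
Qed.

Definition half_graph G : 'M[R]_d := \matrix_(i, j) ((G i j)%:R / 2).

Lemma degree_inl G i : degree G (inl i) = (\sum_j G i j)%N.
Proof. by rewrite /degree big_sumType /= sum_nat_const muln0. Qed.

Lemma degree_inr G j : degree G (inr j) = (\sum_i G i j)%N.
Proof. by rewrite /degree big_sumType /= sum_nat_const muln0 addn0. Qed.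

Lemma half_graph_birkhoff G :
  iota_invariant phi psi G -> (forall v, degree G v = 2%N) ->
  birkhoff_iota phi psi (half_graph G).
Proof.
move=> invG degG; split; [split|].
- by move=> i j; rewrite mxE divr_ge0 ?ler0n.
- move=> i; under eq_bigr do rewrite mxE.
  by rewrite -mulr_suml -natr_sum -degree_inl degG divff ?pnatr_eq0.
- move=> j; under eq_bigr do rewrite mxE.
  by rewrite -mulr_suml -natr_sum -degree_inr degG divff ?pnatr_eq0.
by apply/matrixP => i j; have := invG (inl i) (inr j); rewrite !mxE /= => ->.
Qed.

Lemma half_graph_associated G : associated_graph (half_graph G) G.
Proof. by move=> i j; rewrite mxE mulrC divfK ?pnatr_eq0. Qed.

(** The edges i -- dual_perm s i are the images under iota of the edges
i -- s i. *)
Definition dual_perm s : 'S_d := (phi * s * psi)%g.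

Lemma dual_permE s i : dual_perm s i = psi (s (phi i)).
Proof. by rewrite !permM. Qed.

Definition perm_graph s : bigraph d :=
  \matrix_(i, j) ((s i == j) + (dual_perm s i == j))%N.

Lemma perm_graphE s i j :
  perm_graph s i j = ((s i == j) + (dual_perm s i == j))%N.
Proof. exact: mxE. Qed.

Lemma perm_graph_regular s v : degree (perm_graph s) v = 2%N.
Proof.
have sum_eq (T : finType) (x : T) : (\sum_y (x == y) = 1)%N.
  by rewrite (bigD1 x) //= eqxx big1 // => y; rewrite eq_sym => /negbTE->.
case: v => [i|j]; rewrite ?degree_inl ?degree_inr.
  by under eq_bigr do rewrite mxE; rewrite big_split /= !sum_eq.
under eq_bigr do rewrite mxE; rewrite big_split /=.
have sum_perm (t : 'S_d) : (\sum_i (t i == j) = 1)%N.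
  rewrite (reindex_inj (@perm_inj _ t^-1)) /=.
  by under eq_bigr do rewrite permKV eq_sym; rewrite sum_eq.
by rewrite !sum_perm.
Qed.

Hypotheses (phiK : involutive phi) (psiK : involutive psi).

Lemma perm_graph_invariant s : iota_invariant phi psi (perm_graph s).
Proof.
have invG i j : perm_graph s (phi i) (psi j) = perm_graph s i j.
  rewrite !perm_graphE !dual_permE phiK (inj_eq perm_inj) addnC.
  by congr addn; rewrite -[in RHS](inj_eq (@perm_inj _ psi)) psiK.
by move=> [i|j] [i'|j'] //=.
Qed.

(** Write Q for the iota-average of the permutation matrix of s. Since the
support of M is iota-invariant, it contains that of Q, so M is a proper convex
combination of Q and (M - e Q) / (1 - e) for small e > 0; extremality gives
M = Q. This holds for every permutation in the support of M at once, which is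
what later forces two such permutations to have the same average. *)
Lemma vertex_perm_graph M s :
    is_vertex (birkhoff_iota phi psi) M -> (forall i, 0 < M i (s i)) ->
  associated_graph M (perm_graph s).
Proof.
move=> [[birM invM] extM] Ms; set Q := half_graph (perm_graph s).
have [birQ invQ] : birkhoff_iota phi psi Q.
  exact: half_graph_birkhoff (perm_graph_invariant s) (perm_graph_regular s).
(* The default value 1 / 2 keeps e below 1. *)
pose e := \big[Num.min/(1 / 2 : R)]_i M i (s i).
have e_gt0 : 0 < e by apply: lt_bigmin => //; lra.
have e_lt1 : e < 1 by apply: (@le_lt_trans _ _ (1/2)); [apply: bigmin_le_id|lra].
have e_le i : e <= M i (s i) by apply: bigmin_le.
have invMij i j : M (phi i) (psi j) = M i j by rewrite -[in RHS]invM mxE.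
have e_le' i : e <= M i (dual_perm s i).
  by rewrite dual_permE -(phiK i) invMij phiK.
have eQ i j : e * Q i j <= M i j.
  have M0 : 0 <= M i j by case: birM.
  rewrite mxE perm_graphE natrD.
  have [<-|_] := eqVneq (s i) j; last have [<-|_] := eqVneq (dual_perm s i) j.
  - by have := e_le i; case: (_ == _) => /=; lra.
  - by have := e_le' i; rewrite /=; lra.
  - by rewrite /=; lra.
pose N := (1 - e)^-1 *: (M - e *: Q).
have e1 : 1 - e != 0 by rewrite subr_eq0 eq_sym lt_eqF.
have NE i j : N i j = (1 - e)^-1 * (M i j - e * Q i j) by rewrite !mxE.
have birN : birkhoff_iota phi psi N.
  have [[M0 Mrow Mcol] [Q0 Qrow Qcol]] := (birM, birQ).
  split; [split|].
  - by move=> i j; rewrite NE mulr_ge0 ?invr_ge0 ?subr_ge0 // ltW.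
  - move=> i; under eq_bigr do rewrite NE.
    by rewrite -mulr_sumr sumrB -mulr_sumr Mrow Qrow mulr1 mulVf.
  - move=> j; under eq_bigr do rewrite NE.
    by rewrite -mulr_sumr sumrB -mulr_sumr Mcol Qcol mulr1 mulVf.
  apply/matrixP => i j; rewrite mxE !NE invMij.
  by rewrite -[in RHS]invQ [in RHS]mxE.
have [] := extM Q N e (conj birQ invQ) birN; first by rewrite e_gt0.
  by rewrite /N scalerA divff // scale1r addrC subrK.
by move=> <- _; apply: half_graph_associated.
Qed.

End Vertices.

(** * Rigidity of typed graphs *)

Section Graph.
Variables (d : nat) (phi psi : 'S_d).
Hypotheses (phiK : involutive phi) (psiK : involutive psi).
Implicit Types (G : bigraph d) (u v w : bivertex d).

Local Notation iota := (iotaV phi psi).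

Lemma edge_multC G u v : edge_mult G u v = edge_mult G v u.
Proof. by case: u v => [i|i] [j|j]. Qed.

Lemma adjacentC G : symmetric (adjacent G).
Proof. by move=> u v; rewrite /adjacent /= edge_multC. Qed.

Lemma adjacent_irrefl G v : adjacent G v v = false.
Proof. by case: v. Qed.

Lemma adjacent_third G u v w x :
    degree G u = 2%N -> adjacent G u v -> adjacent G u w -> v != w ->
  adjacent G u x -> (x == v) || (x == w).
Proof.
rewrite /degree => degu uv uw vw ux; apply: contraTT isT; rewrite negb_or.
case/andP=> xv xw; suff: (2 < degree G u)%N by rewrite /degree degu.
rewrite /degree (bigD1 v) //= (bigD1 w) 1?eq_sym //= (bigD1 x) /= ?xv //.
move: uv uw ux; rewrite /adjacent /=; lia.
Qed.

(** The edge weightings D that are shown to vanish are differences of two points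
of the invariant polytope supported on the edges of G. *)
Section Flow.
Variables (R : numFieldType) (G : bigraph d) (D : bivertex d -> bivertex d -> R).
Hypotheses (invG : iota_invariant phi psi G) (degG : forall v, degree G v = 2%N).
Hypotheses (D0 : forall u v, ~~ adjacent G u v -> D u v = 0)
  (DC : forall u v, D u v = D v u) (Dsum : forall u, \sum_v D u v = 0)
  (Diota : forall u v, D (iota u) (iota v) = D u v).

Lemma flow_other u v : D u v != 0 -> exists2 w, w != v & D u w != 0.
Proof.
move=> Duv; apply/exists_inP; apply: contraNT Duv.
rewrite negb_exists_in => /forall_inP Du0.
rewrite -(Dsum u) (bigD1 v) //= big1 ?addr0 // => w wv.
by apply/eqP; rewrite -[_ == _]negbK Du0.
Qed.

Lemma flow_adjacent u v : D u v != 0 -> adjacent G u v.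
Proof. by apply: contraNT => /D0->. Qed.

(** The vertex u has at most two neighbours, with opposite values of D. *)
Lemma flow_propagates u v w : adjacent G u v -> D u v = 0 -> D u w = 0.
Proof.
move=> uv Duv; apply/eqP/contraT => Duw; have [x xw Dux] := flow_other Duw.
have neq_v y : D u y != 0 -> y != v by apply: contraNneq => ->; rewrite Duv.
have := adjacent_third (degG u) (flow_adjacent Duw) (flow_adjacent Dux) _ uv.
rewrite eq_sym xw ![v == _]eq_sym (negbTE (neq_v _ Duw)).
by rewrite (negbTE (neq_v _ Dux)) => /(_ isT).
Qed.

(** Crossing an edge, the previous lemma applies to the new endpoint, by the
symmetry of D. *)
Lemma flow_component u v w :
  connect (adjacent G) u v -> (forall x, D u x = 0) -> D v w = 0.
Proof.
case/connectP=> p up -> {v}; elim: p u up w => //= v p IHp u /andP[uv vp] w Du0.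
apply: IHp => // x; apply: (@flow_propagates _ u).
  by rewrite adjacentC.
by rewrite DC.
Qed.

(** The two edges at v are exchanged by iota, so D takes the same value on both,
and these values sum to zero. *)
Lemma flow_swap v u : iota v = v -> adjacent G v u -> iota u != u -> D v u = 0.
Proof.
move=> fixv vu uN; have vu' : adjacent G v (iota u).
  by rewrite /adjacent /= -{1}fixv invG.
have Du' : D v (iota u) = D v u by rewrite -{1}fixv Diota.
apply/eqP; have := Dsum v.
rewrite (bigD1 u) //= (bigD1 (iota u)) //= big1 => [|x].
  by rewrite Du' addr0 -mulr2n => /eqP; rewrite mulrn_eq0.
case/andP=> xu xu'; apply/D0/negP => vx.
have := adjacent_third (degG v) vu vu' _ vx.
by rewrite eq_sym uN (negbTE xu) (negbTE xu') => /(_ isT).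
Qed.

(** A nonzero value at v would come with a second one, hence with a second
neighbour of v. *)
Lemma flow_two_cycle v w :
  #|[set x | connect (adjacent G) v x]| = 2%N -> D v w = 0.
Proof.
move=> card2; apply/eqP/contraT => Dw; have [x xw Dx] := flow_other Dw.
suff: (2 < #|[set x | connect (adjacent G) v x]|)%N by rewrite card2.
apply/card_gt2P; exists v, w, x; split; first split.
- by rewrite inE connect0.
- by rewrite inE connect1 ?flow_adjacent.
- by rewrite inE connect1 ?flow_adjacent.
split.
- by apply: contraTneq (flow_adjacent Dw) => <-; rewrite adjacent_irrefl.
- by rewrite eq_sym.
rewrite eq_sym; apply: contraTneq (flow_adjacent Dx) => <-.
by rewrite adjacent_irrefl.
Qed.

(** If every neighbour of a fixed vertex were fixed, connectedness would make
all of C fixed, but C has only two fixed vertices and 2 < |C|. So some fixed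
vertex has a neighbour that iota moves, and D vanishes there. *)
Lemma flow_fixed_component v :
  let C := [set x | connect (adjacent G) v x] in
    (#|fixed_left phi psi C| + #|fixed_right phi psi C| = 2)%N -> (2 < #|C|)%N ->
  forall w, D v w = 0.
Proof.
move=> C fix2 gt2 w.
have symG : connect_sym (adjacent G) := sym_connect_sym (adjacentC G).
pose F := [set x in C | iota x == x].
have cardF : #|F| = 2%N.
  rewrite -fix2 -(cardsID [set x | Defs.is_left x] F).
  congr (_ + _)%N; apply: eq_card => x.
    by rewrite !inE -andbA; congr (_ && _); rewrite andbC.
  by rewrite !inE andbCA.
have [u Fu [x ux xN]] : exists2 u, u \in F & exists2 x, adjacent G u x & iota x != x.
  have [/exists_inP[u Fu /exists_inP[x ux xN]]|noF] :=
      boolP [exists u in F, [exists x in adjacent G u, iota x != x]].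
    by exists u => //; exists x.
  suff FC : C \subset F by have := subset_leq_card FC; rewrite cardF leqNgt gt2.
  have /card_gt0P[u] : (0 < #|F|)%N by rewrite cardF.
  have clF : closed (adjacent G) F.
    apply: intro_closed => // y z yz Fy.
    move: noF; rewrite negb_exists_in => /forall_inP/(_ y Fy).
    rewrite negb_exists_in => /forall_inP/(_ z yz); rewrite negbK => fixz.
    move: Fy; rewrite !inE fixz andbT => /andP[vy _].
    exact: connect_trans vy (connect1 yz).
  move=> Fu; apply/subsetP => y; rewrite inE => vy.
  rewrite -(closed_connect clF (_ : connect _ u y)) //.
  by apply: connect_trans vy; rewrite symG; move: Fu; rewrite !inE => /andP[].
move: Fu; rewrite !inE => /andP[vu /eqP fixu].
apply: (@flow_component u); first by rewrite symG.
by move=> y; apply: (flow_propagates y ux (flow_swap fixu ux xN)).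
Qed.

Lemma typed_flow_eq0 : all_cycles_typed phi psi G -> forall v w, D v w = 0.
Proof.
move=> typG v w; set C := [set x | connect (adjacent G) v x].
have [[C2 _]|[C2 _]|[[k [k0 Ck]] L R']|[[k [k0 Ck]] LR]] :=
  typG C (ex_intro _ v erefl).
- exact: flow_two_cycle.
- exact: flow_two_cycle.
- by apply: flow_fixed_component; rewrite ?L ?R' // Ck; lia.
- by apply: flow_fixed_component; [case: LR => -[-> ->]|rewrite Ck; lia].
Qed.

End Flow.

(** If M is a proper convex combination of y and z, then the entries of y and z,
being nonnegative, vanish where those of M do; the differences y - M and z - M are then flows on the edges of
G. *)
Lemma typed_graph_vertex (R : realType) G :
    iota_invariant phi psi G -> (forall v, degree G v = 2%N) ->
    all_cycles_typed phi psi G ->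
  is_vertex (birkhoff_iota phi psi) (half_graph R G).
Proof.
move=> invG degG typG; set M := half_graph R G.
have birM : birkhoff_iota phi psi M := half_graph_birkhoff R invG degG.
suff uniqM y : birkhoff_iota phi psi y ->
    (forall i j, M i j = 0 -> y i j = 0) -> y = M.
  split=> // y z t birY birZ /andP[t0 t1] defM.
  have yz0 i j : M i j = 0 -> y i j = 0 /\ z i j = 0.
    have [[y0 _ _] _] := birY; have [[z0 _ _] _] := birZ.
    rewrite defM !mxE => /eqP; rewrite paddr_eq0 ?mulr_ge0 ?subr_ge0 // 1?ltW //.
    by rewrite !mulf_eq0 gt_eqF // subr_eq0 [1 == t]gt_eqF //= => /andP[/eqP-> /eqP->].
  by split; apply: uniqM => // i j /yz0[].
move=> [[y0 yrow ycol] yinv] ysupp.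
have [[M0 Mrow Mcol] Minv] := birM.
pose D u v := match u, v with
  | inl i, inr j => y i j - M i j
  | inr j, inl i => y i j - M i j
  | _, _ => 0 end.
have D0 : forall u v, D u v = 0.
  apply: (@typed_flow_eq0 _ G) => //.
  - have y0G i j : ~~ (0 < G i j)%N -> y i j - M i j = 0.
      rewrite -eqn0Ngt => /eqP Gij; have Mij : M i j = 0 by rewrite mxE Gij mul0r.
      by rewrite ysupp ?Mij ?subrr.
    by move=> [i|i] [j|j] //=; apply: y0G.
  - by move=> [i|i] [j|j].
  - move=> [i|j]; rewrite big_sumType /= big1_eq ?add0r ?addr0 sumrB.
      by rewrite yrow Mrow subrr.
    by rewrite ycol Mcol subrr.
  have Dinv i j : y (phi i) (psi j) - M (phi i) (psi j) = y i j - M i j.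
    by rewrite -[in RHS]yinv -[in RHS]Minv !mxE.
  by move=> [i|i] [j|j] //=.
by apply/matrixP => i j; apply/eqP; rewrite -subr_eq0; apply/eqP/(D0 (inl i) (inr j)).
Qed.

End Graph.

(** * Fixed points of two involutions on an orbit of their product *)

Section Dihedral.
Variables (T : finType) (a b : {perm T}).
Hypotheses (aK : involutive a) (bK : involutive b).

Local Notation tau := (b * a)%g.
Local Notation f x k := (iter k tau x).

Lemma iter_porbit_eq x k m :
  (f x k == f x m) = (k == m %[mod #|porbit tau x|]).
Proof.
set n := #|_|; have n_gt0 : (0 < n)%N by rewrite lt0n card_porbit_neq0.
have fmod i : f x i = f x (i %% n).
  rewrite {1}(divn_eq i n) addnC iterD; congr iter.
  by elim: (i %/ n)%N => // j IHj; rewrite mulSn iterD IHj iter_porbit.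
rewrite (fmod k) (fmod m) -!(nth_traject _ (ltn_pmod _ n_gt0)).
by rewrite nth_uniq ?size_traject ?ltn_pmod ?uniq_traject_porbit.
Qed.

(** Since a inverts tau, walking k steps from the mirror image of the point
reached after k steps leads to the mirror image of the start. *)
Lemma iter_reflect x k : f (a (f x k)) k = a x.
Proof.
elim: k => // k IHk; rewrite iterSr [f x _]iterS.
by rewrite [(b * a)%g (a _)]permM [(b * a)%g (f _ _)]permM aK bK IHk.
Qed.

Lemma fixed_a_iter x k : (a (f x k) == f x k) = (a x == f x k.*2).
Proof.
rewrite -(iter_reflect x k) -addnn iterD [RHS]inj_eq //.
by elim: (k) => //= m IHm; apply: inj_comp IHm; apply: perm_inj.
Qed.

Lemma fixed_b_iter x k : (b (f x k) == f x k) = (a x == f x k.*2.+1).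
Proof.
rewrite -(inj_eq (@perm_inj _ a)) -permM -iterS eq_sym.
rewrite -(iter_reflect x k) -addnn -addnS iterD [RHS]inj_eq //.
by elim: (k) => //= m IHm; apply: inj_comp IHm; apply: perm_inj.
Qed.

Lemma card_porbit_pred x (h : pred T) (g : pred nat) :
    (forall k, h (f x k) = g k) ->
  #|[set y in porbit tau x | h y]| = #|[set k : 'I_#|porbit tau x| | g k]|.
Proof.
move=> hg; set n := #|porbit tau x|.
have finj : injective (fun k : 'I_n => f x k).
  move=> k m /eqP; rewrite iter_porbit_eq !modn_small // => /eqP; exact: val_inj.
rewrite -(card_imset _ finj); apply: eq_card => y; rewrite inE porbit_traject.
apply/andP/imsetP => [[/trajectP[k ltkn ->]]|[k gk ->]].
  by rewrite hg => gk; exists (Ordinal ltkn); rewrite ?inE.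
by split; [apply/trajectP; exists k | rewrite hg; rewrite inE in gk].
Qed.

Lemma card_ord_pred0 n (g : pred nat) :
  (forall k, k < n -> ~~ g k)%N -> #|[set k : 'I_n | g k]| = 0%N.
Proof.
by move=> gN; apply: eq_card0 => k; rewrite inE; apply/negbTE/gN.
Qed.

Lemma card_ord_pred1 n (g : pred nat) m :
    (m < n)%N -> (forall k, k < n -> g k = (k == m))%N ->
  #|[set k : 'I_n | g k]| = 1%N.
Proof.
move=> ltmn gE; rewrite -(cards1 (Ordinal ltmn)); apply: eq_card => k.
by rewrite !inE gE.
Qed.

Lemma card_ord_pred2 n (g : pred nat) m m' :
    (m < n)%N -> (m' < n)%N -> m != m' ->
    (forall k, k < n -> g k = (k == m) || (k == m'))%N ->
  #|[set k : 'I_n | g k]| = 2%N.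
Proof.
move=> ltmn ltmn' mm' gE.
transitivity #|[set Ordinal ltmn; Ordinal ltmn']|; last by rewrite cards2 mm'.
by apply: eq_card => k; rewrite !inE gE.
Qed.

(** On the cycle x, tau x, tau^2 x, ..., of length n, let a x be at position c.
Then the point at position k is fixed by a when 2 k = c modulo n, and by b when
2 k + 1 = c modulo n. For 0 <= k < n these congruences are equalities with c or
c + n, so each of the numbers c and c + n gives one fixed point, of a if it is
even and of b if it is odd; their parities differ exactly for odd n. *)
Lemma card_fixed_porbit x :
    let O := porbit tau x in
    let fa := #|[set y in O | a y == y]| in
    let fb := #|[set y in O | b y == y]| in
    a x \in O ->
  if odd #|O| then fa = 1%N /\ fb = 1%N
  else (fa = 2%N /\ fb = 0%N) \/ (fa = 0%N /\ fb = 2%N).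
Proof.
move=> O fa fb; rewrite /O porbit_traject => /trajectP[c ltcn ax].
(* g 0 and g 1 single out the positions of the fixed points of a and b. *)
pose g e k := (k.*2 + e == c) || (k.*2 + e == c + #|O|)%N.
have gE e k : (e <= 1)%N -> (k < #|O|)%N -> (a x == f x (k.*2 + e)) = g e k.
  move=> e1 ltkn; rewrite ax iter_porbit_eq /g -/O.
  set n := #|O| in ltcn ltkn *; rewrite (modn_small ltcn).
  have [lt2|ge2] := ltnP (k.*2 + e) n; first by rewrite modn_small //; lia.
  rewrite -{1}(subnK ge2) modnDr modn_small; lia.
have faE : fa = #|[set k : 'I_#|O| | g 0%N k]|.
  rewrite /fa (card_porbit_pred (fun k => fixed_a_iter x k)) -/O.
  by apply: eq_card => k; rewrite !inE -gE // addn0.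
have fbE : fb = #|[set k : 'I_#|O| | g 1%N k]|.
  rewrite /fb (card_porbit_pred (fun k => fixed_b_iter x k)) -/O.
  by apply: eq_card => k; rewrite !inE -gE // addn1.
rewrite {}faE {}fbE -/O; rewrite -/O in ltcn; set n := #|O| in g ltcn gE *.
have [oddn|evenn] := boolP (odd n).
  have [oddc|evenc] := boolP (odd c); split.
  - by apply: (@card_ord_pred1 _ (g _) (c + n)./2) => [|k ltkn]; rewrite /g; lia.
  - by apply: (@card_ord_pred1 _ (g _) c./2) => [|k ltkn]; rewrite /g; lia.
  - by apply: (@card_ord_pred1 _ (g _) c./2) => [|k ltkn]; rewrite /g; lia.
  - by apply: (@card_ord_pred1 _ (g _) (c + n)./2) => [|k ltkn]; rewrite /g; lia.
have [oddc|evenc] := boolP (odd c); [right|left]; split.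
- by apply: (@card_ord_pred0 _ (g _)) => k ltkn; rewrite /g; lia.
- by apply: (@card_ord_pred2 _ (g _) c./2 (c + n)./2) => [|||k ltkn];
     rewrite /g; lia.
- by apply: (@card_ord_pred2 _ (g _) c./2 (c + n)./2) => [|||k ltkn];
     rewrite /g; lia.
by apply: (@card_ord_pred0 _ (g _)) => k ltkn; rewrite /g; lia.
Qed.

End Dihedral.

(** * Cycles of the graph of a permutation and its image under iota *)

Section PermGraph.
Variables (d : nat) (phi psi s : 'S_d).
Hypotheses (phiK : involutive phi) (psiK : involutive psi).

Local Notation G := (perm_graph phi psi s).
Local Notation s' := (dual_perm phi psi s).

(** The action of psi on the right vertices, read on the left ones by pulling
back along the edges of s. *)
Definition right_invol : 'S_d := (s * psi * s^-1)%g.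

(** One step along an edge of s and back along an edge of its image under iota:
see dual_walk. *)
Definition walk : 'S_d := (right_invol * phi)%g.

Lemma right_involE i : s (right_invol i) = psi (s i).
Proof. by rewrite !permM permKV. Qed.

Lemma right_involK : involutive right_invol.
Proof. by move=> i; apply: (@perm_inj _ s); rewrite !right_involE psiK. Qed.

Lemma dual_walk i : s' (walk i) = s i.
Proof. by rewrite dual_permE permM phiK right_involE psiK. Qed.

Lemma walk1_phi i : walk i = i -> s (phi i) = psi (s i).
Proof. by move=> wi; rewrite -[in LHS]wi permM phiK right_involE. Qed.

Lemma adjacent_perm_graph i j :
  adjacent G (inl i) (inr j) = (s i == j) || (s' i == j).
Proof. by rewrite /adjacent /= perm_graphE; do 2!case: (_ == _). Qed.

Definition orbit_vertices (O : {set 'I_d}) : {set bivertex d} :=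
  inl @: O :|: inr @: (s @: O).

Lemma inl_orbit_vertices O i : (inl i \in orbit_vertices O) = (i \in O).
Proof.
rewrite in_setU mem_imset; last by move=> ? ? [].
by rewrite orbC; case: imsetP => // -[].
Qed.

Lemma inr_orbit_vertices O i : (inr (s i) \in orbit_vertices O) = (i \in O).
Proof.
rewrite in_setU [X in _ || X]mem_imset; last by move=> ? ? [].
by rewrite mem_imset; [case: imsetP => // -[]|exact: perm_inj].
Qed.

Lemma card_orbit_vertices O : #|orbit_vertices O| = (2 * #|O|)%N.
Proof.
rewrite cardsU [X in (_ - X)%N]eq_card0 => [|v].
  rewrite !card_imset ?mul2n ?addnn ?subn0 //; [exact: perm_inj|by move=> ? ? []..].
by rewrite !inE; apply/andP => -[/imsetP[i _ ->] /imsetP[]].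
Qed.

(** The orbit is closed under adjacency because every edge has the form
k -- s k or walk k -- s k, and connected because these two edges meet. *)
Lemma perm_graph_component i :
  [set w | connect (adjacent G) (inl i) w] = orbit_vertices (porbit walk i).
Proof.
set O := porbit walk i.
have symG : connect_sym (adjacent G) := sym_connect_sym (@adjacentC _ G).
have Owalk k : (walk k \in O) = (k \in O).
  by rewrite ![_ \in O]porbit_sym (porbit_perm walk 1).
have clO : closed (adjacent G) (orbit_vertices O).
  apply: intro_closed => // -[k|j] [k'|j'] // uv.
    move: uv; rewrite adjacent_perm_graph inl_orbit_vertices => /orP[]/eqP<- kO.
      by rewrite inr_orbit_vertices.
    by rewrite -(permKV walk k) dual_walk inr_orbit_vertices -Owalk permKV.
  move: uv; rewrite adjacentC adjacent_perm_graph inl_orbit_vertices => /orP[]/eqP<-.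
    by rewrite inr_orbit_vertices.
  by rewrite -(permKV walk k') dual_walk inr_orbit_vertices Owalk.
have right k : connect (adjacent G) (inl k) (inr (s k)).
  by apply: connect1; rewrite adjacent_perm_graph eqxx.
have step k : connect (adjacent G) (inl k) (inl (walk k)).
  apply: connect_trans (right k) _; rewrite symG; apply: connect1.
  by rewrite adjacent_perm_graph dual_walk eqxx orbT.
have reach k : k \in O -> connect (adjacent G) (inl i) (inl k).
  case/porbitP=> n ->; rewrite permX; elim: n => [|n IHn]; first exact: connect0.
  exact: connect_trans IHn (step _).
apply/setP => w; rewrite inE; apply/idP/idP => [iw|].
  by rewrite -(closed_connect clO iw) inl_orbit_vertices porbit_id.
case/setUP=> /imsetP[k Ok ->]; first exact: reach.
by case/imsetP: Ok => k' Ok' ->; apply: connect_trans (right k'); apply: reach.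
Qed.

Lemma is_cycle_perm_graph C :
  is_cycle G C <-> exists i, C = orbit_vertices (porbit walk i).
Proof.
split=> [[[i|j] ->]|[i ->]].
- by exists i; apply: perm_graph_component.
- exists (s^-1 j)%g; rewrite -perm_graph_component; apply/setP => w; rewrite !inE.
  apply: (same_connect (sym_connect_sym (@adjacentC _ G))); apply: connect1.
  by rewrite adjacentC adjacent_perm_graph permKV eqxx.
by exists (inl i); rewrite perm_graph_component.
Qed.

Lemma card_fixed_left O :
  #|fixed_left phi psi (orbit_vertices O)| = #|[set i in O | phi i == i]|.
Proof.
rewrite -(card_imset _ (_ : injective (@inl 'I_d 'I_d))); last by move=> ? ? [].
apply: eq_card => -[i|j]; rewrite inE.
  rewrite inl_orbit_vertices mem_imset ?inE //=; by move=> ? ? [].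
by rewrite andbF; symmetry; apply/imsetP => -[].
Qed.

Lemma card_fixed_right O :
  #|fixed_right phi psi (orbit_vertices O)| = #|[set i in O | right_invol i == i]|.
Proof.
have injr : injective (fun i => inr (s i) : bivertex d).
  by move=> i k [] /perm_inj.
rewrite -(card_imset _ injr); apply: eq_card => -[i|j]; rewrite inE.
  by rewrite andbF; symmetry; apply/imsetP => -[].
rewrite -(permKV s j) inr_orbit_vertices mem_imset ?inE //=.
by congr (_ && _); rewrite -[RHS](inj_eq (@perm_inj _ s)) right_involE.
Qed.

Lemma orbit_vertices1 i : orbit_vertices [set i] = [set inl i; inr (s i)].
Proof. by rewrite /orbit_vertices !imset_set1. Qed.

Lemma porbit1 i : walk i = i -> porbit walk i = [set i].
Proof.
move=> wi; apply/setP => k; rewrite inE; apply/porbitP/eqP => [[n ->]|->].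
  by rewrite permX; elim: n => //= n ->.
by exists 0%N; rewrite expg0 perm1.
Qed.

(** The hypothesis says that a cycle which iota does not preserve is a 2-cycle;
it is then of type 2. For a cycle preserved by iota, card_fixed_porbit counts
the fixed points; an orbit of size 1 is of type 1, and otherwise odd sizes give
type 3 and even sizes type 4. *)
Lemma perm_graph_typed :
    (forall i, phi i \notin porbit walk i -> walk i = i) ->
  all_cycles_typed phi psi G.
Proof.
move=> walk1 C /is_cycle_perm_graph[i ->]; set O := porbit walk i.
have [Ophi|nOphi] := boolP (phi i \in O); last first.
  have wi := walk1 i nOphi.
  have wphi : walk (phi i) = phi i.
    rewrite permM; congr (phi _); apply: (@perm_inj _ s).
    by rewrite right_involE walk1_phi ?psiK.
  have nfixi : phi i != i.
    by apply: contraNneq nOphi => ->; apply: porbit_id.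
  rewrite /O porbit1 //; constructor 2.
  rewrite /cycle_type2 card_orbit_vertices cards1; split=> //.
  exists (orbit_vertices [set phi i]); rewrite card_orbit_vertices cards1; split=> //.
  - by apply/is_cycle_perm_graph; exists (phi i); rewrite porbit1.
  - move/setP/(_ (inl i)); rewrite !inl_orbit_vertices !inE eqxx.
    by rewrite eq_sym (negbTE nfixi).
  - by rewrite !orbit_vertices1 imsetU1 imset_set1 /= walk1_phi.
  - by rewrite !orbit_vertices1 imsetU1 imset_set1 /= phiK walk1_phi // psiK.
have := card_fixed_porbit phiK right_involK Ophi; rewrite -/walk -/O.
rewrite -card_fixed_left -card_fixed_right; have := card_orbit_vertices O.
have O_gt0 : (0 < #|O|)%N by rewrite lt0n card_porbit_neq0.
have [/cards1P[i' Oi']|O1] := boolP (#|O| == 1%N).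
  have {i' Oi'}OE : O = [set i].
    by rewrite Oi'; have := porbit_id walk i; rewrite -/O Oi' inE => /eqP->.
  move=> cardC _; constructor 1; rewrite /cycle_type1 cardC OE cards1; split=> // v.
  have wi : walk i = i.
    by apply/set1P; rewrite -OE (mem_porbit walk 1).
  have fixi : phi i = i by apply/set1P; rewrite -OE.
  rewrite orbit_vertices1 !inE => /orP[]/eqP-> /=; first by rewrite fixi.
  by rewrite -walk1_phi ?fixi.
case: ifP => [oddO cardC [fl fr]|evenO cardC flr].
  constructor 3; split=> //; exists (#|O|./2); rewrite cardC; lia.
constructor 4; split=> //; exists (#|O|./2); rewrite cardC; lia.
Qed.

End PermGraph.

(** Let O be an orbit that phi moves off itself. The permutation r, equal to s
on O and to s' elsewhere, is injective because s and s' have the same image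
on O. Both r and its image under iota agree with s on O; as M is the average of
the two, its weight on the edge i -- s i is 1, and so s' i = s i. *)
Lemma vertex_graph_typed (R : realType) (d : nat) (phi psi : 'S_d) (M : 'M[R]_d) :
    involutive phi -> involutive psi -> is_vertex (birkhoff_iota phi psi) M ->
  exists G, associated_graph M G /\ all_cycles_typed phi psi G.
Proof.
move=> phiK psiK vM; have [s Ms] := birkhoff_support_perm (proj1 (proj1 vM)).
have MG := vertex_perm_graph phiK psiK vM Ms.
exists (perm_graph phi psi s); split=> //.
set s' := dual_perm phi psi s; set tau := walk phi psi s.
have Ms' i : 0 < M i (s' i).
  have := MG i (s' i); rewrite perm_graphE eqxx addn1 => MGi.
  by have := ltr0Sn R (s i == s' i); rewrite MGi; lra.
apply: perm_graph_typed => // i; set O := porbit _ i => phiO.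
have OE k : (tau k \in O) = (k \in O).
  by rewrite ![_ \in O]porbit_sym (porbit_perm _ 1).
pose r k := if k \in O then s k else s' k.
have injr : injective r.
  suff neq k m : k \in O -> m \notin O -> s k != s' m.
    move=> k m; rewrite /r; case: ifPn => kO; case: ifPn => mO; try exact: perm_inj.
      by move=> eq_r; have := neq k m kO mO; rewrite eq_r eqxx.
    by move=> eq_r; have := neq m k mO kO; rewrite eq_r eqxx.
  move=> kO; apply: contraNneq => eq_s.
  by rewrite -(perm_inj (etrans (dual_walk s phiK psiK k) eq_s)) OE.
have Mr k : 0 < M k (perm injr k) by rewrite permE /r; case: ifP.
suff eq_s : s' i = s i.
  by apply: (@perm_inj _ s'); rewrite [LHS]dual_walk.
have := vertex_perm_graph phiK psiK vM Mr i (s i); rewrite -MG => /eqP.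
rewrite eqr_nat !perm_graphE -/s' [dual_perm _ _ (perm _) i]dual_permE !(permE injr).
rewrite /r porbit_id (negbTE phiO) /s' !dual_permE phiK psiK !eqxx.
by case: (psi _ =P _).
Qed.

(** Conjugating a root twice gives the root back, and distinct indices carry
distinct roots. *)
Lemma conj_perm_involutive (R : realType) (d : nat) (alpha : 'I_d -> R[i])
    (s : 'S_d) :
  injective alpha -> conj_perm alpha s -> involutive s.
Proof. by move=> inja sE i; apply: inja; rewrite !sE conjcK. Qed.

Theorem theorem3p6 (R : realType) (d : nat) (p q : {poly R})
    (alpha beta : 'I_d -> R[i]) (phi psi : 'S_d)
    (hp : distinct_roots p alpha) (hq : distinct_roots q beta)
    (hphi : conj_perm alpha phi) (hpsi : conj_perm beta psi) :
  (forall M : 'M[R]_d, is_vertex (birkhoff_iota phi psi) M ->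
     exists G : bigraph d, associated_graph M G /\ all_cycles_typed phi psi G)
  /\
  (forall G : bigraph d,
     iota_invariant phi psi G -> (forall v, degree G v = 2%N) ->
     all_cycles_typed phi psi G ->
     exists M : 'M[R]_d,
       is_vertex (birkhoff_iota phi psi) M /\ associated_graph M G).
Proof.
have [_ inja _] := hp; have [_ injb _] := hq.
have phiK := conj_perm_involutive inja hphi.
have psiK := conj_perm_involutive injb hpsi.
split=> [M|G invG degG typG]; first exact: vertex_graph_typed.
exists (half_graph R G); split; last exact: half_graph_associated.
exact: typed_graph_vertex.
Qed.
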